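(* For $\varepsilon\in(0,1)$ and $d\in\mathbb{N}$ we have $$N_2^{\rm per}(\varepsilon,d)\ge\frac{1}{1+\varepsilon^2}\left(\frac32\right)^d\quad\text{and}\quad N_2^{\rm per,w+}(\varepsilon,d)\ge(1-\varepsilon^2)\left(\frac32\right)^d.$$ Moreover, for any $\varepsilon_0\in(0,1)$ there exists $c>0$ such that $N_2^{\rm per,w}(\varepsilon,d)\ge c\,1.0628^d$ for all $d\in\mathbb{N}$ and all $\varepsilon\in(0,\varepsilon_0)$.
   Context: For $x,y\in[0,1)$ define $I(x,y)=[x,y)$ if $x\le y$ and $I(x,y)=[0,y)\cup[x,1)$ if $x>y$; for $\boldsymbol{x},\boldsymbol{y}\in[0,1)^d$ let $B(\boldsymbol{x},\boldsymbol{y})=I(x_1,y_1)\times\cdots\times I(x_d,y_d)$. For a point set $\mathcal{P}=\{\boldsymbol{x}_1,\ldots,\boldsymbol{x}_N\}\subset[0,1)^d$ with real weights $\boldsymbol{w}=(w_1,\ldots,w_N)$, let $\Delta_{\mathcal{P}}(B,\boldsymbol{w})=\sum_{j:\boldsymbol{x}_j\in B}w_j-\mathrm{volume}(B)$ and $L_{2,N}^{\rm per}(\mathcal{P},\boldsymbol{w})=\big(\int_{[0,1]^d}\int_{[0,1]^d}\Delta_{\mathcal{P}}(B(\boldsymbol{x},\boldsymbol{y}),\boldsymbol{w})^2\,{\rm d}\boldsymbol{x}\,{\rm d}\boldsymbol{y}\big)^{1/2}$; write $L_{2,N}^{\rm per}(\mathcal{P})$ for equal weights $w_j=1/N$. Define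 $N_2^{\rm per}(\varepsilon,d)=\min\{N\in\mathbb{N}:\exists\,\mathcal{P}\subseteq[0,1)^d,\ |\mathcal{P}|=N,\ L_{2,N}^{\rm per}(\mathcal{P})\le\varepsilon\,3^{-d/2}\}$; $N_2^{\rm per,w}(\varepsilon,d)$ is defined in the same way but with the minimum over all $N$ for which there exist an $N$-point set $\mathcal{P}$ and arbitrary real weights $\boldsymbol{w}$ with $L_{2,N}^{\rm per}(\mathcal{P},\boldsymbol{w})\le\varepsilon\,3^{-d/2}$; and $N_2^{\rm per,w+}(\varepsilon,d)$ is defined in the same way with only positive weights allowed. (Here $3^{-d/2}$ is the periodic $L_2$-discrepancy of the empty point set.) *)

(* Defs.v *)
From HB Require Import structures.
From mathcomp Require Import all_boot all_order all_algebra.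
From mathcomp Require Import all_classical all_reals all_analysis.
Set Implicit Arguments. Unset Strict Implicit. Unset Printing Implicit Defensive.
Import Order.TTheory GRing.Theory Num.Theory.
Local Open Scope ring_scope.
Local Open Scope classical_set_scope.

Section PerDisc.
Variable R : realType.

Definition upd (z : nat -> R) (k : nat) (t : R) : nat -> R :=
  fun i => if i == k then t else z i.

Fixpoint iint (n : nat) (F : (nat -> R) -> \bar R) {struct n} : \bar R :=
  match n with
  | 0 => F (fun _ => 0)
  | n'.+1 => (\int[@lebesgue_measure R]_(t in `[0%R, 1%R]) iint n' (fun z => F (upd z n' t)))%E
  end.

Definition inI (a b t : R) : bool :=
  if a <= b then (a <= t) && (t < b) else ((0 <= t) && (t < b)) || ((a <= t) && (t < 1)).

Definition lenI (a b : R) : R := if a <= b then b - a else 1 - a + b.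

Definition inB (d : nat) (x y p : nat -> R) : bool :=
  [forall i : 'I_d, inI (x i) (y i) (p i)].

Definition volB (d : nat) (x y : nat -> R) : R := \prod_(i < d) lenI (x i) (y i).

Definition Delta (d N : nat) (P : 'I_N -> (nat -> R)) (w : 'I_N -> R) (x y : nat -> R) : R :=
  \sum_(j < N | inB d x y (P j)) w j - volB d x y.

(* (L_{2,N}^per(P,w))^2: coordinates 0..d-1 of z are x, d..2d-1 are y *)
Definition L2per_sq (d N : nat) (P : 'I_N -> (nat -> R)) (w : 'I_N -> R) : \bar R :=
  iint (d + d) (fun z => ((Delta d P w z (fun i => z (d + i)%N)) ^+ 2)%:E).

Definition pointset (d N : nat) (P : 'I_N -> (nat -> R)) : Prop :=
  injective (fun j : 'I_N => \row_(i < d) P j i) /\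
  forall j : 'I_N, forall i : 'I_d, 0 <= P j i < 1.

(* L_{2,N}^per(P,w) <= eps * 3^{-d/2}, i.e. its square is <= (eps 3^{-d/2})^2 *)
Definition admissible (eps : R) (d N : nat) (P : 'I_N -> (nat -> R)) (w : 'I_N -> R) : Prop :=
  (L2per_sq d P w <= ((eps * (Num.sqrt 3 ^+ d)^-1) ^+ 2)%:E)%E.

Definition eqw (N : nat) : 'I_N -> R := fun _ => N%:R^-1.

End PerDisc.

(* Main.v *)
(* Integrating one coordinate pair at a time shows that the squared discrepancy equals
   3^-d (1 - 2 W) + Q, where W is the sum of the weights and Q
   the quadratic form of the weights in the kernel prod_i K(x_i - y_i), with
   K(u) = 1/2 - |u| + u^2 = 1/3 + B_2(|u|).  A bound N Q >= rho^d W^2 gives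
   N >= (1 - eps^2) (3 rho)^d by minimizing over W.  For positive weights the diagonal
   entries 2^-d and Cauchy-Schwarz give rho = 1/2.  For arbitrary weights put
   A = (1 + 3 K) / 4.  Then K - A^2 = 77/960 + B_2/16 - 9 B_4/16 is positive semidefinite,
   B_2 and - B_4 being autocorrelations, so by the Schur product theorem Q dominates the
   form of the Schur square of prod_i A; Vybiral's bound for Schur squares then gives
   rho = A(0)^2 = 25/64, and 3 rho = 75/64 exceeds 1.0628. *)

Require Import Defs.
From HB Require Import structures.
From mathcomp Require Import all_boot all_order all_algebra.
From mathcomp Require Import all_classical all_reals all_analysis.
From mathcomp Require Import measurable_realfun ring lra.
Import Order.TTheory GRing.Theory Num.Theory.
Import numFieldNormedType.Exports.
Local Open Scope ring_scope.

Set Implicit Arguments.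
Unset Strict Implicit.
Unset Printing Implicit Defensive.

Local Open Scope classical_set_scope.

(** * Integrals of piecewise polynomials *)

Section HasIntegral.
Context {R : realType}.
Local Notation mu := (@lebesgue_measure R).
Implicit Types (f g : R -> R) (a b c d u v w : R).

(** Integrability is recorded together with the value, so that sums, multiples and concatenations
    need no measure-theoretic side conditions later. *)
Definition has_int f a b v : Prop :=
  mu.-integrable `[a, b] (EFin \o f) /\
  (\int[mu]_(x in `[a, b]) (f x)%:E = v%:E)%E.

Lemma eq_has_int f g a b v : f =1 g -> has_int f a b v -> has_int g a b v.
Proof. by move=> /funext ->. Qed.

Lemma has_intD f g a b u v : has_int f a b u -> has_int g a b v ->
  has_int (fun x => f x + g x) a b (u + v).
Proof.
move=> [fi fE] [gi gE]; split; first by have := integrableD _ fi gi; apply.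
rewrite EFinD -fE -gE -integralD//.
Qed.

Lemma has_intZ k f a b v : has_int f a b v -> has_int (fun x => k * f x) a b (k * v).
Proof.
move=> [fi fE]; split; first by have := integrableZl _ k fi; apply.
by rewrite EFinM -fE -integralZl.
Qed.

Lemma has_int0 a b : has_int (fun=> 0) a b 0.
Proof.
split; first exact: integrable0.
by rewrite integral0.
Qed.

Lemma has_int_sum (I : Type) (s : seq I) (P : pred I) (f : I -> R -> R) a b (v : I -> R) :
  (forall i, P i -> has_int (f i) a b (v i)) ->
  has_int (fun x => \sum_(i <- s | P i) f i x) a b (\sum_(i <- s | P i) v i).
Proof.
move=> fv; elim: s => [|i s ih].
  rewrite big_nil; apply: eq_has_int (has_int0 a b) => x; by rewrite big_nil.
rewrite big_cons; case: ifPn => Pi.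
  by apply: eq_has_int (has_intD (fv _ Pi) ih) => x; rewrite big_cons Pi.
by apply: eq_has_int ih => x; rewrite big_cons (negbTE Pi).
Qed.

Lemma has_int_ge0 f a b v : (forall x, 0 <= f x) -> has_int f a b v -> 0 <= v.
Proof.
move=> f0 [_ fE]; rewrite -lee_fin -fE.
by apply: integral_ge0 => x _; rewrite lee_fin.
Qed.

Lemma has_int_concat f a b c u v : a <= b -> b <= c ->
  has_int f a b u -> has_int f b c v -> has_int f a c (u + v).
Proof.
move=> ab bc [fi1 fE1] [fi2 fE2].
(* Dropping the null point [b] from the second interval makes the two pieces disjoint. *)
have fi2' : mu.-integrable `]b, c] (EFin \o f).
  by apply: integrableS fi2 => //; apply: subset_itvr; rewrite bnd_simp.
have fE2' : (\int[mu]_(x in `]b, c]) (f x)%:E = v%:E)%E.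
  by rewrite integral_itv_obnd_cbnd ?fE2//; apply: measurable_int fi2'.
have E : `[a, c] = `[a, b] `|` `]b, c] :> set R.
  by rewrite (@itv_bndbnd_setU _ _ _ (BRight b))// bnd_simp.
have disj : [disjoint `[a, b] & `]b, c] : set R].
  apply/disj_setPRL => x /=; rewrite !in_itv/= => /andP[bx _] /andP[_].
  by rewrite leNgt bx.
have mf : measurable_fun (`[a, b] `|` `]b, c]) (EFin \o f).
  by apply/measurable_funU => //; split; [exact: measurable_int fi1|exact: measurable_int fi2'].
split; rewrite E.
  apply/integrableP; split=> //.
  rewrite integral_setU//; last exact: measurableT_comp.
  by apply: lte_add_pinfty; [case/integrableP: fi1|case/integrableP: fi2'].
by rewrite integral_setU// fE1 fE2'.
Qed.

(** The endpoints form a null set, so a piecewise function needs to match its formula only strictly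
    between breakpoints. *)
Lemma has_int_oo f g a b v : (forall x, a < x < b -> f x = g x) ->
  has_int g a b v -> has_int f a b v.
Proof.
move=> fg [gi gE].
have mg : measurable_fun `]a, b[ (EFin \o g).
  by apply: measurable_int (integrableS _ _ _ gi) => //; apply: subset_itv; rewrite bnd_simp.
have fgo : {in `]a, b[, EFin \o g =1 EFin \o f}.
  by move=> x; rewrite inE/= in_itv/= => /fg ->.
have mf : measurable_fun `]a, b[ (EFin \o f) by exact: eq_measurable_fun mg.
split.
  apply/integrableP; split; first exact: (emeasurable_fun_itv_cc mf).
  rewrite integral_itv_bndoo; last exact: measurableT_comp.
  case/integrableP: gi => _; rewrite integral_itv_bndoo; last exact: measurableT_comp.
  move=> hg; apply: le_lt_trans hg; rewrite le_eqVlt; apply/orP; left; apply/eqP.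
  by apply: eq_integral => x xab; rewrite -(fgo x xab).
rewrite -gE integral_itv_bndoo// [RHS]integral_itv_bndoo//.
by apply: eq_integral => x /fgo /=.
Qed.

Lemma has_int_horner (p : {poly R}) a b : a <= b ->
  has_int (horner p^`()) a b (p.[b] - p.[a]).
Proof.
move=> ab; split.
  apply: continuous_compact_integrable; first exact: segment_compact.
  by apply: continuous_subspaceT => x; exact: continuous_horner.
(* The fundamental theorem of calculus is used for a nondegenerate interval; at [a = b] both sides
   vanish. *)
move: ab; rewrite le_eqVlt => /orP[/eqP <-|ab].
  by rewrite set_itv1 integral_set1 subrr.
rewrite (@continuous_FTC2 _ _ (horner p))//.
- by apply: continuous_subspaceT => x; exact: continuous_horner.
- split.
  + by move=> x _; exact: derivable_horner.
  + by apply: cvg_at_right_filter; exact: continuous_horner.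
  + by apply: cvg_at_left_filter; exact: continuous_horner.
- by move=> x _; rewrite derivE.
Qed.

(* Degree 4 is what the autocorrelation of the Bernoulli polynomial B_2 needs. *)
Lemma has_int_quartic (c0 c1 c2 c3 c4 : R) f a b : a <= b ->
  (forall x, a < x < b -> f x = c0 + c1 * x + c2 * x ^+ 2 + c3 * x ^+ 3 + c4 * x ^+ 4) ->
  has_int f a b (c0 * (b - a) + c1 / 2 * (b ^+ 2 - a ^+ 2) + c2 / 3 * (b ^+ 3 - a ^+ 3)
    + c3 / 4 * (b ^+ 4 - a ^+ 4) + c4 / 5 * (b ^+ 5 - a ^+ 5)).
Proof.
move=> ab fE.
pose p : {poly R} := c0 *: 'X + (c1 / 2) *: 'X^2 + (c2 / 3) *: 'X^3 + (c3 / 4) *: 'X^4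
  + (c4 / 5) *: 'X^5.
have -> : c0 * (b - a) + c1 / 2 * (b ^+ 2 - a ^+ 2) + c2 / 3 * (b ^+ 3 - a ^+ 3)
    + c3 / 4 * (b ^+ 4 - a ^+ 4) + c4 / 5 * (b ^+ 5 - a ^+ 5) = p.[b] - p.[a].
  by rewrite /p !(hornerD, hornerZ, hornerX, hornerXn); ring.
apply: has_int_oo (has_int_horner p ab) => x /fE ->.
by rewrite /p !(derivD, derivZ, derivX, derivXn)
  !(hornerD, hornerZ, hornerX, hornerXn, hornerC, hornerMn) /=;
  field.
Qed.

Lemma has_int_cst k f a b : a <= b -> (forall x, a < x < b -> f x = k) ->
  has_int f a b (k * (b - a)).
Proof.
move=> ab fk; have := @has_int_quartic k 0 0 0 0 f a b ab.
by rewrite !mul0r !addr0; apply=> x /fk ->; ring.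
Qed.

Lemma has_int_concat3 f a b c d u v w : a <= b -> b <= c -> c <= d ->
  has_int f a b u -> has_int f b c v -> has_int f c d w -> has_int f a d (u + (v + w)).
Proof.
move=> ab bc cd fu fv fw; apply: (has_int_concat ab (le_trans bc cd) fu).
exact: has_int_concat bc cd fv fw.
Qed.

End HasIntegral.

(** * Positive semidefinite matrices *)

Section PositiveSemidefinite.
Context {R : rcfType} {T : finType}.
Implicit Types (M L : T -> T -> R) (c : T -> R).

Definition qform M c : R := \sum_j \sum_k c j * c k * M j k.

Definition psd M : Prop := (forall j k, M j k = M k j) /\ forall c, 0 <= qform M c.

Lemma eq_psd M L : (forall j k, M j k = L j k) -> psd M -> psd L.
Proof. by move=> ML; have -> : L = M by apply/funext => j; apply/funext => k; rewrite ML. Qed.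

Lemma qformD M L c : qform (fun j k => M j k + L j k) c = qform M c + qform L c.
Proof.
rewrite /qform -big_split; apply: eq_bigr => j _ /=.
by rewrite -big_split; apply: eq_bigr => k _; rewrite mulrDr.
Qed.

Lemma qformZ (a : R) M c : qform (fun j k => a * M j k) c = a * qform M c.
Proof.
rewrite /qform mulr_sumr; apply: eq_bigr => j _.
by rewrite mulr_sumr; apply: eq_bigr => k _; rewrite mulrCA.
Qed.

Lemma qform_rank1 (v c : T -> R) :
  qform (fun j k => v j * v k) c = (\sum_j c j * v j) ^+ 2.
Proof.
rewrite /qform expr2 mulr_suml; apply: eq_bigr => j _.
by rewrite mulr_sumr; apply: eq_bigr => k _; rewrite mulrACA.
Qed.

Lemma qform_diag (a : R) M c :
  (forall j k, 0 <= M j k) -> (forall j, 0 <= c j) -> (forall j, M j j = a) ->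
  a * \sum_j c j ^+ 2 <= qform M c.
Proof.
move=> M0 c0 Ma; rewrite /qform mulr_sumr; apply: ler_sum => j _.
rewrite (bigD1 j)//= Ma -expr2 mulrC lerDl.
by apply: sumr_ge0 => k _; rewrite !mulr_ge0.
Qed.

Lemma psdD M L : psd M -> psd L -> psd (fun j k => M j k + L j k).
Proof.
move=> [sM pM] [sL pL]; split=> [j k|c]; first by rewrite sM sL.
by rewrite qformD addr_ge0.
Qed.

Lemma psdZ (a : R) M : 0 <= a -> psd M -> psd (fun j k => a * M j k).
Proof.
move=> a0 [sM pM]; split=> [j k|c]; first by rewrite sM.
by rewrite qformZ mulr_ge0.
Qed.

Lemma psd_rank1 (v : T -> R) : psd (fun j k => v j * v k).
Proof.
split=> [j k|c]; first exact: mulrC.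
by rewrite qform_rank1 sqr_ge0.
Qed.

Lemma psd_cst (a : R) : 0 <= a -> psd (fun _ _ => a).
Proof.
move=> a0; apply: eq_psd (psdZ a0 (psd_rank1 (fun=> 1))) => j k.
by rewrite !mulr1.
Qed.

Lemma psd_sum (I : finType) (P : pred I) (M : I -> T -> T -> R) :
  (forall i, P i -> psd (M i)) -> psd (fun j k => \sum_(i | P i) M i j k).
Proof.
move=> pM; rewrite /index_enum; elim: (Finite.enum I) => [|i s ih].
  by apply: eq_psd (psd_cst (lexx 0)) => j k; rewrite big_nil.
case Pi : (P i).
  by apply: eq_psd (psdD (pM _ Pi) ih) => j k; rewrite big_cons Pi.
by apply: eq_psd ih => j k; rewrite big_cons Pi.
Qed.

(** A shift along one coordinate direction makes the form a quadratic polynomial in [a]; choosing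
    [a] well yields the facts about pivots below. *)
Lemma qform_add_delta M c s (a : R) : (forall j k, M j k = M k j) ->
  qform M (fun j => c j + a * (j == s)%:R) =
  qform M c + 2 * a * (\sum_j c j * M j s) + a ^+ 2 * M s s.
Proof.
move=> sM; rewrite /qform.
have sumdelta (g : T -> R) : \sum_k (k == s)%:R * g k = g s.
  rewrite (bigD1 s)//= eqxx mul1r big1 ?addr0// => k /negbTE ->.
  by rewrite mul0r.
transitivity (\sum_j ((\sum_k c j * c k * M j k) + a * (c j * M j s)
    + a * ((j == s)%:R * \sum_k c k * M j k) + a ^+ 2 * ((j == s)%:R * M j s))).
  apply: eq_bigr => j _.
  rewrite -(sumdelta (M j)) !mulr_sumr -!big_split/=.
  by apply: eq_bigr => k _; ring.
rewrite !big_split/= -!mulr_sumr !sumdelta.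
have -> : \sum_k c k * M s k = \sum_k c k * M k s by apply: eq_bigr => k _; rewrite sM.
by ring.
Qed.

Lemma psd_diag_ge0 M s : psd M -> 0 <= M s s.
Proof.
move=> [sM pM]; have := pM (fun j => 0 + 1 * (j == s)%:R).
rewrite qform_add_delta// /qform !big1 => [|j _|j _]; rewrite ?mul0r//; last first.
  by rewrite big1// => k _; rewrite !mul0r.
by rewrite mulr0 !add0r expr1n mul1r.
Qed.

Lemma psd_diag0 M s j : psd M -> M s s = 0 -> M j s = 0.
Proof.
move=> [sM pM] Ms; apply/eqP/negPn/negP => Mjs.
(* With a zero pivot the form at [e_j + a e_s] is affine in [a]; this [a] gives it the value -1. *)
pose a := - (M j j + 1) / (2 * M j s).
have := pM (fun k => (k == j)%:R + a * (k == s)%:R).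
have sumdelta (g : T -> R) : \sum_k (k == j)%:R * g k = g j.
  rewrite (bigD1 j)//= eqxx mul1r big1 ?addr0// => k /negbTE ->.
  by rewrite mul0r.
rewrite qform_add_delta// Ms sumdelta.
have -> : qform M (fun k => (k == j)%:R) = M j j.
  rewrite /qform -[RHS](sumdelta (M^~ j)); apply: eq_bigr => i _.
  rewrite -(sumdelta (M i)) mulr_sumr; by apply: eq_bigr => k _; rewrite mulrA.
have -> : 2 * a * M j s = - (M j j + 1) by rewrite /a; field.
by rewrite mulr0 addr0; lra.
Qed.

(* Cholesky factorization: one pivot is eliminated at a time, [S] being the set of
   the rows that are possibly nonzero. *)
Lemma psd_gram_supp (S : {set T}) M : psd M -> (forall j k, j \notin S -> M j k = 0) ->
  exists V : T -> T -> R, forall j k, M j k = \sum_(i in S) V i j * V i k.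
Proof.
elim: {S}_.+1 {-2}S (ltnSn #|S|) M => // m ih S Sm M pM MS.
have [S0|[s sS]] := set_0Vmem S.
  by exists (fun _ _ => 0) => j k; rewrite S0 big_set0 MS// S0 inE.
have Sm' : (#|S :\ s| < m)%N by move: Sm; rewrite (cardsD1 s S) sS.
have [sM _] := pM.
(* A zero pivot has a zero row, so [s] leaves the support and contributes the zero vector. *)
have [Ms0|Ms0] := eqVneq (M s s) 0.
  have MS' j k : j \notin S :\ s -> M j k = 0.
    rewrite !inE negb_and negbK => /orP[/eqP ->|/MS//].
    by rewrite sM; exact: psd_diag0.
  have [V MV] := ih _ Sm' _ pM MS'.
  exists (fun i j => if i == s then 0 else V i j) => j k.
  rewrite MV (big_setD1 s sS)/= eqxx mul0r add0r; apply: eq_bigr => i.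
  by rewrite !inE => /andP[/negbTE -> _].
have Msp : 0 < M s s by rewrite lt_neqAle eq_sym Ms0 psd_diag_ge0.
(* The Schur complement of the pivot. *)
pose M' j k := M j k - M j s * M k s / M s s.
have pM' : psd M'.
  split=> [j k|c]; first by rewrite /M' sM (mulrC (M j s)).
  (* Completing the square: the form of the Schur complement is the minimum of the form of [M] over
     changes of coordinate [s]. *)
  have -> : qform M' c = qform M (fun j => c j + - ((\sum_j c j * M j s) / M s s) * (j == s)%:R).
    rewrite qform_add_delta//.
    have -> : M' = fun j k => M j k + (- (M s s)^-1) * (M j s * M k s).
      by apply/funext => j; apply/funext => k; rewrite /M' mulrC mulNr.
    rewrite qformD qformZ qform_rank1; by field.
  by case: pM => _; apply.
have M'S j k : j \notin S :\ s -> M' j k = 0.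
  rewrite !inE negb_and negbK => /orP[/eqP ->|jS]; last by rewrite /M' !(MS j)// !mul0r subr0.
  by rewrite /M' (sM k s) mulrAC divff// mul1r subrr.
have [V MV] := ih _ Sm' _ pM' M'S.
exists (fun i j => if i == s then M j s / Num.sqrt (M s s) else V i j) => j k.
rewrite (big_setD1 s sS)/= eqxx mulf_div -expr2 sqr_sqrtr ?ltW//.
transitivity (M j s * M k s / M s s + M' j k); first by rewrite /M'; ring.
congr (_ + _); rewrite MV; apply: eq_bigr => i.
by rewrite !inE => /andP[/negbTE -> _].
Qed.

Lemma psd_gram M : psd M ->
  exists V : T -> T -> R, forall j k, M j k = \sum_i V i j * V i k.
Proof.
move=> pM; have [|V MV] := @psd_gram_supp [set: T] M pM; first by move=> j k; rewrite inE.
by exists V => j k; rewrite MV; apply: eq_bigl => i; rewrite inE.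
Qed.

(** Schur product theorem: a Gram decomposition of [M] writes the entrywise product as a sum of
    matrices [D L D] with [D] diagonal. *)
Lemma psdM M L : psd M -> psd L -> psd (fun j k => M j k * L j k).
Proof.
move=> /psd_gram[V MV] [sL pL].
apply: (eq_psd (M := fun j k => \sum_i V i j * V i k * L j k)) => [j k|].
  by rewrite MV mulr_suml.
apply: psd_sum => i _; split=> [j k|c]; first by rewrite sL (mulrC (V i j)).
rewrite (_ : qform _ _ = qform L (fun j => c j * V i j)) ?pL//.
by apply: eq_bigr => j _; apply: eq_bigr => k _; ring.
Qed.

Lemma psd_prod (I : Type) (s : seq I) (M : I -> T -> T -> R) :
  (forall i, psd (M i)) -> psd (fun j k => \prod_(i <- s) M i j k).
Proof.
move=> pM; elim: s => [|i s ih].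
  by apply: eq_psd (psd_cst ler01) => j k; rewrite big_nil.
by apply: eq_psd (psdM (pM i) ih) => j k; rewrite big_cons.
Qed.

(** Telescoping, with [m], [l] the products over the tail: [M_i m - L_i l = M_i (m - l) + (M_i -
    L_i) l], and each summand is a Schur product. *)
Lemma psd_prodB (I : Type) (s : seq I) (M L : I -> T -> T -> R) :
  (forall i, psd (L i)) -> (forall i, psd (fun j k => M i j k - L i j k)) ->
  psd (fun j k => \prod_(i <- s) M i j k - \prod_(i <- s) L i j k).
Proof.
move=> pL pML; have pM i : psd (M i).
  by apply: eq_psd (psdD (pML i) (pL i)) => j k; rewrite subrK.
elim: s => [|i s ih].
  by apply: eq_psd (psd_cst (lexx 0)) => j k; rewrite !big_nil subrr.
apply: eq_psd (psdD (psdM (pM i) ih) (psdM (pML i) (psd_prod s pL))) => j k.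
by rewrite !big_cons; ring.
Qed.

(** Cauchy-Schwarz against the all-ones vector, by averaging [a_i a_j <= (a_i^2 + a_j^2) / 2] over
    all pairs. *)
Lemma sum_sqr_le (a : T -> R) : (\sum_i a i) ^+ 2 <= #|T|%:R * \sum_i a i ^+ 2.
Proof.
have -> : #|T|%:R * \sum_i a i ^+ 2 = \sum_i \sum_j (a i ^+ 2 + a j ^+ 2) / 2.
  transitivity (\sum_i (#|T|%:R * a i ^+ 2 + \sum_j a j ^+ 2) / 2).
    rewrite -mulr_suml big_split/= sumr_const -mulr_sumr -[X in _ + X]mulr_natl; by field.
  by apply: eq_bigr => i _; rewrite -mulr_suml big_split/= sumr_const mulr_natl.
rewrite expr2 mulr_suml; apply: ler_sum => i _; rewrite mulr_sumr; apply: ler_sum => j _.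
have := sqr_ge0 (a i - a j); lra.
Qed.

(* Vybiral's lower bound for Schur squares: with [G] a Gram matrix of vectors
   [v_j], the left-hand side is the squared trace of [sum_j c_j v_j v_j^T] and the
   quadratic form on the right is its squared Frobenius norm. *)
Lemma schur_sqr_ge G c : psd G ->
  (\sum_j c j * G j j) ^+ 2 <= #|T|%:R * qform (fun j k => G j k ^+ 2) c.
Proof.
move=> /psd_gram[V GV]; pose A i l := \sum_j c j * (V i j * V l j).
have -> : \sum_j c j * G j j = \sum_i A i i.
  rewrite exchange_big; apply: eq_bigr => j _.
  by rewrite GV mulr_sumr.
have -> : qform (fun j k => G j k ^+ 2) c = \sum_i \sum_l A i l ^+ 2.
  rewrite /qform.
  transitivity (\sum_j \sum_k \sum_i \sum_l
      c j * c k * ((V i j * V l j) * (V i k * V l k))).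
    apply: eq_bigr => j _; apply: eq_bigr => k _.
    rewrite expr2 GV mulr_suml mulr_sumr; apply: eq_bigr => i _.
    by rewrite mulr_sumr mulr_sumr; apply: eq_bigr => l _; ring.
  under eq_bigr => j _ do rewrite exchange_big.
  rewrite exchange_big; apply: eq_bigr => i _.
  under eq_bigr => j _ do rewrite exchange_big.
  rewrite exchange_big; apply: eq_bigr => l _.
  exact: (qform_rank1 (fun j => V i j * V l j)).
(* Cauchy-Schwarz on the diagonal of [A], whose order is [#|T|], followed by adding the off-diagonal
   squares. *)
apply: le_trans (sum_sqr_le _) _; rewrite ler_wpM2l//.
apply: ler_sum => i _; rewrite (bigD1 i)//= lerDl.
by apply: sumr_ge0 => l _; exact: sqr_ge0.
Qed.

End PositiveSemidefinite.

(** * The periodic kernel *)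

Section PeriodicKernel.
Context {R : realType}.
Implicit Types (a b x y s t u v : R).

Definition ker a b : R := 1 / 2 - `|a - b| + (a - b) ^+ 2.

Lemma kerC a b : ker a b = ker b a.
Proof. by rewrite /ker distrC -(sqrrN (a - b)) opprB. Qed.

Lemma ker_diag a : ker a a = 1 / 2.
Proof. by rewrite /ker subrr normr0 expr0n/= subr0 addr0. Qed.

Lemma ker_le a b : a <= b -> ker a b = 1 / 2 - (b - a) + (b - a) ^+ 2.
Proof. by move=> ab; rewrite kerC /ker ger0_norm// subr_ge0. Qed.

Lemma ker_ge a b : b <= a -> ker a b = 1 / 2 - (a - b) + (a - b) ^+ 2.
Proof. by move=> ab; rewrite /ker ger0_norm// subr_ge0. Qed.

Lemma ker_ge0 a b : 0 <= ker a b.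
Proof.
rewrite /ker -real_normK ?num_real//.
have := sqr_ge0 (`|a - b| - 1 / 2); lra.
Qed.

(** The inner integral runs over [x] with [y] frozen, matching [iint], where later coordinates are
    integrated further outside. *)
Definition has_int2 (f : R -> R -> R) v : Prop :=
  exists2 g : R -> R, forall y, 0 <= y <= 1 -> has_int (f^~ y) 0 1 (g y) & has_int g 0 1 v.

Lemma has_int_eqv f a b u v : u = v -> has_int f a b u -> has_int f a b v.
Proof. by move=> ->. Qed.

(** The disjuncts are the three rotations of the cyclic order in which the arc from [x] to [y]
    contains [a]. *)
Lemma inI_true x y a : 0 <= a < 1 ->
  [|| x <= a < y, a < y < x | y < x <= a] -> inI x y a = true.
Proof.
move=> /andP[a0 a1]; rewrite /inI a0 a1 /= andbT => /or3P[] /andP[h1 h2].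
- by rewrite (le_trans h1 (ltW h2)) h1 h2.
- by rewrite leNgt h2 h1.
- by rewrite leNgt h1 h2 orbT.
Qed.

Lemma inI_false x y a :
  [|| x <= y <= a, y <= a < x | a < x <= y] -> inI x y a = false.
Proof.
rewrite /inI => /or3P[] /andP[h1 h2].
- by rewrite h1 (le_gtF h2) andbF.
- by rewrite (lt_geF (le_lt_trans h1 h2)) (le_gtF h1) (lt_geF h2) andbF.
- by rewrite h2 (lt_geF h1).
Qed.

Lemma lenI_le x y : x <= y -> lenI x y = y - x.
Proof. by rewrite /lenI => ->. Qed.

Lemma lenI_gt x y : y < x -> lenI x y = 1 - x + y.
Proof. by rewrite /lenI leNgt => ->. Qed.

Lemma has_int2_inI_le a b : 0 <= a < 1 -> 0 <= b < 1 -> a <= b ->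
  has_int2 (fun x y => (inI x y a)%:R * (inI x y b)%:R) (ker a b).
Proof.
move=> a01 b01 ab.
(* The measure of the starting points [x] whose arc ending at [y] contains both [a] and [b]. *)
exists (fun y => if y <= a then a - y else if y <= b then b - y else 1 - y + a).
  move=> y y01; case: (leP y a) => ya; [|case: (leP y b) => yb].
  - apply: (@has_int_eqv _ _ _ (_ + (_ + _))); last first.
      apply: (@has_int_concat3 _ _ _ y a); [lra|lra|lra|..].
      + by apply: (@has_int_cst _ 0) => [|x ?];
          [lra|rewrite (inI_false (a := a)) ?mul0r ?mulr0 ?mul1r//; lra].
      + by apply: (@has_int_cst _ 1) => [|x ?];
          [lra|rewrite (inI_true (a := a)) ?(inI_true (a := b)) ?mul0r ?mulr0 ?mul1r//; lra].
      + by apply: (@has_int_cst _ 0) => [|x ?];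
          [lra|rewrite (inI_false (a := a)) ?mul0r ?mulr0 ?mul1r//; lra].
    by field.
  - apply: (@has_int_eqv _ _ _ (_ + (_ + _))); last first.
      apply: (@has_int_concat3 _ _ _ y b); [lra|lra|lra|..].
      + by apply: (@has_int_cst _ 0) => [|x ?];
          [lra|rewrite (inI_false (a := b)) ?mul0r ?mulr0 ?mul1r//; lra].
      + by apply: (@has_int_cst _ 1) => [|x ?];
          [lra|rewrite (inI_true (a := a)) ?(inI_true (a := b)) ?mul0r ?mulr0 ?mul1r//; lra].
      + by apply: (@has_int_cst _ 0) => [|x ?];
          [lra|rewrite (inI_false (a := b)) ?mul0r ?mulr0 ?mul1r//; lra].
    by field.
  - apply: (@has_int_eqv _ _ _ (_ + (_ + _))); last first.
      apply: (@has_int_concat3 _ _ _ a y); [lra|lra|lra|..].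
      + by apply: (@has_int_cst _ 1) => [|x ?];
          [lra|rewrite (inI_true (a := a)) ?(inI_true (a := b)) ?mul0r ?mulr0 ?mul1r//; lra].
      + by apply: (@has_int_cst _ 0) => [|x ?];
          [lra|rewrite (inI_false (a := a)) ?mul0r ?mulr0 ?mul1r//; lra].
      + by apply: (@has_int_cst _ 1) => [|x ?];
          [lra|rewrite (inI_true (a := a)) ?(inI_true (a := b)) ?mul0r ?mulr0 ?mul1r//; lra].
    by field.
apply: (@has_int_eqv _ _ _ (_ + (_ + _))); last first.
  apply: (@has_int_concat3 _ _ _ a b); [lra|lra|lra|..].
  + by apply: (@has_int_quartic _ a (-1) 0 0 0) => [|x ?]; [lra|rewrite ifT; [ring|lra]].
  + by apply: (@has_int_quartic _ b (-1) 0 0 0) => [|x ?]; [lra|rewrite lt_geF ?ifT; [ring|lra..]].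
  + by apply: (@has_int_quartic _ (1 + a) (-1) 0 0 0) => [|x ?];
      [lra|rewrite !lt_geF; [ring|lra..]].
by rewrite ker_le//; field.
Qed.

Lemma has_int2_inI a b : 0 <= a < 1 -> 0 <= b < 1 ->
  has_int2 (fun x y => (inI x y a)%:R * (inI x y b)%:R) (ker a b).
Proof.
move=> a01 b01; have [|/ltW] := leP a b; first exact: has_int2_inI_le.
move=> /(has_int2_inI_le b01 a01)[g gi gv]; rewrite kerC; exists g => // y /gi.
by apply: eq_has_int => x; rewrite mulrC.
Qed.

Lemma has_int2_inI_lenI a : 0 <= a < 1 ->
  has_int2 (fun x y => (inI x y a)%:R * lenI x y) (1 / 3).
Proof.
move=> a01.
(* An arc ending at [y] contains [a] when its length is at least the cyclic distance [D] from [a] to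
   [y], up to a null set; integrating the length from [D] to 1 gives [(1 - D^2) / 2]. *)
exists (fun y => if y <= a then (1 - (1 - a + y) ^+ 2) / 2 else (1 - (y - a) ^+ 2) / 2).
  move=> y y01; case: (leP y a) => ya.
  - apply: (@has_int_eqv _ _ _ (_ + (_ + _))); last first.
      apply: (@has_int_concat3 _ _ _ y a); [lra|lra|lra|..].
      + by apply: (@has_int_cst _ 0) => [|x ?];
          [lra|rewrite (inI_false (a := a)) ?mul0r ?mulr0 ?mul1r//; lra].
      + by apply: (@has_int_quartic _ (1 + y) (-1) 0 0 0) => [|x ?];
          [lra|rewrite (inI_true (a := a)) ?lenI_gt /=; [ring|lra..]].
      + by apply: (@has_int_cst _ 0) => [|x ?];
          [lra|rewrite (inI_false (a := a)) ?mul0r ?mulr0 ?mul1r//; lra].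
    by field.
  - apply: (@has_int_eqv _ _ _ (_ + (_ + _))); last first.
      apply: (@has_int_concat3 _ _ _ a y); [lra|lra|lra|..].
      + by apply: (@has_int_quartic _ y (-1) 0 0 0) => [|x ?];
          [lra|rewrite (inI_true (a := a)) ?lenI_le /=; [ring|lra..]].
      + by apply: (@has_int_cst _ 0) => [|x ?];
          [lra|rewrite (inI_false (a := a)) ?mul0r ?mulr0 ?mul1r//; lra].
      + by apply: (@has_int_quartic _ (1 + y) (-1) 0 0 0) => [|x ?];
          [lra|rewrite (inI_true (a := a)) ?lenI_gt /=; [ring|lra..]].
    by field.
apply: (@has_int_eqv _ _ _ (_ + _)); last first.
  apply: (@has_int_concat _ _ _ a); [lra|lra|..].
  + apply: (@has_int_quartic _ ((1 - (1 - a) ^+ 2) / 2) (- (1 - a)) (- (1 / 2)) 0 0)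
      => [|x ?]; first lra.
    by case: leP => ?; [field|lra].
  + apply: (@has_int_quartic _ ((1 - a ^+ 2) / 2) a (- (1 / 2)) 0 0) => [|x ?]; first lra.
    by case: leP => ?; [lra|field].
by field.
Qed.

Lemma has_int2_lenI : has_int2 (fun x y => lenI x y * lenI x y) (1 / 3).
Proof.
(* For every [y] the arc length is uniformly distributed on the unit interval. *)
exists (fun=> 1 / 3).
  move=> y y01; apply: (@has_int_eqv _ _ _ (_ + _)); last first.
    apply: (@has_int_concat _ _ _ y); [lra|lra|..].
    + by apply: (@has_int_quartic _ (y ^+ 2) (- 2 * y) 1 0 0) => [|x ?];
        [lra|rewrite lenI_le; [ring|lra]].
    + by apply: (@has_int_quartic _ ((1 + y) ^+ 2) (- 2 * (1 + y)) 1 0 0) => [|x ?];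
        [lra|rewrite lenI_gt; [ring|lra]].
  by field.
apply: (@has_int_eqv _ _ _ _); last first.
  by apply: (@has_int_quartic _ (1 / 3) 0 0 0 0) => [|x _]; [lra|ring].
by field.
Qed.

(* The periodized Bernoulli polynomial B_1, whose autocorrelation is B_2 / 2; up to
   the mean 1/3, [ker] is B_2 of the distance. *)
Definition saw s u : R := if s < u then s - u + 1 / 2 else s - u - 1 / 2.

Lemma has_int_saw s t : 0 <= s < 1 -> 0 <= t < 1 -> s <= t ->
  has_int (fun u => saw s u * saw t u) 0 1 ((ker s t - 1 / 3) / 2).
Proof.
move=> s01 t01 st.
have left_of c u : u <= c -> saw c u = c - u - 1 / 2 by rewrite /saw ltNge => ->.
have right_of c u : c < u -> saw c u = c - u + 1 / 2 by rewrite /saw => ->.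
apply: (@has_int_eqv _ _ _ (_ + (_ + _))); last first.
  apply: (@has_int_concat3 _ _ _ s t); [lra|lra|lra|..].
  + apply: (@has_int_quartic _ ((s - 1 / 2) * (t - 1 / 2)) (- (s + t - 1)) 1 0 0)
      => [|x ?]; first lra.
    by rewrite !left_of; [field|lra..].
  + apply: (@has_int_quartic _ ((s + 1 / 2) * (t - 1 / 2)) (- (s + t)) 1 0 0) => [|x ?]; first lra.
    by rewrite right_of ?left_of; [field|lra..].
  + apply: (@has_int_quartic _ ((s + 1 / 2) * (t + 1 / 2)) (- (s + t + 1)) 1 0 0)
      => [|x ?]; first lra.
    by rewrite !right_of; [field|lra..].
by rewrite ker_le//; field.
Qed.

Lemma has_int_quadraticM (a0 a1 b0 b1 : R) f g x y : x <= y ->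
  (forall u, x < u < y -> f u = a0 + a1 * u + u ^+ 2) ->
  (forall u, x < u < y -> g u = b0 + b1 * u + u ^+ 2) ->
  has_int (fun u => f u * g u) x y
    (a0 * b0 * (y - x) + (a0 * b1 + a1 * b0) / 2 * (y ^+ 2 - x ^+ 2)
     + (a0 + a1 * b1 + b0) / 3 * (y ^+ 3 - x ^+ 3) + (a1 + b1) / 4 * (y ^+ 4 - x ^+ 4)
     + 1 / 5 * (y ^+ 5 - x ^+ 5)).
Proof.
move=> xy fE gE; apply: has_int_quartic => // u xuy.
by rewrite fE// gE//; ring.
Qed.

(* The autocorrelation of B_2 is - B_4 / 6, and B_2 ^ 2 = B_4 + B_2 / 3 + 1 / 180. *)
Lemma has_int_ker s t : 0 <= s < 1 -> 0 <= t < 1 -> s <= t ->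
  has_int (fun u => (ker s u - 1 / 3) * (ker t u - 1 / 3)) 0 1
    ((1 / 180 + (ker s t - 1 / 3) / 3 - (ker s t - 1 / 3) ^+ 2) / 6).
Proof.
move=> s01 t01 st.
have left_of c u : u <= c -> ker c u - 1 / 3 = (1 / 6 - c + c ^+ 2) + (1 - 2 * c) * u + u ^+ 2.
  by move=> uc; rewrite ker_ge//; field.
have right_of c u : c <= u -> ker c u - 1 / 3 = (1 / 6 + c + c ^+ 2) + (- 1 - 2 * c) * u + u ^+ 2.
  by move=> cu; rewrite ker_le//; field.
apply: (@has_int_eqv _ _ _ (_ + (_ + _))); last first.
  apply: (@has_int_concat3 _ _ _ s t); [lra|lra|lra|..].
  + by apply: has_int_quadraticM => [|u ?|u ?]; [lra|apply: left_of; lra..].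
  + by apply: has_int_quadraticM => [|u ?|u ?]; [lra|apply: right_of; lra|apply: left_of; lra].
  + by apply: has_int_quadraticM => [|u ?|u ?]; [lra|apply: right_of; lra..].
by rewrite ker_le//; field.
Qed.

End PeriodicKernel.

(** * Positive semidefinite matrices built from the kernel *)

Section KernelMatrices.
Context {R : realType}.

(** A matrix of inner products of functions: its form is the integral of the square of a linear
    combination. *)
Lemma psd_has_int (T : finType) (f : T -> R -> R) (M : T -> T -> R) (a b : R) :
  (forall j k, has_int (fun u => f j u * f k u) a b (M j k)) ->
  (forall j k, M j k = M k j) -> psd M.
Proof.
move=> fM sM; split=> // c.
apply: (@has_int_ge0 _ (fun u => qform (fun j k => f j u * f k u) c) a b).
  by move=> u; rewrite qform_rank1 sqr_ge0.
by do 2![apply: has_int_sum => ? _]; apply: has_intZ.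
Qed.

Variables (T : finType) (p : T -> R).
Hypothesis p01 : forall j, 0 <= p j < 1.

Lemma psd_ker_third : psd (fun j k => ker (p j) (p k) - 1 / 3).
Proof.
have h : psd (fun j k => (ker (p j) (p k) - 1 / 3) / 2).
  apply: (@psd_has_int _ (fun j => saw (p j)) _ 0 1) => [j k|j k]; last by rewrite kerC.
  case: (leP (p j) (p k)) => [jk|/ltW kj]; first exact: has_int_saw.
  rewrite kerC; apply: eq_has_int (has_int_saw (p01 k) (p01 j) kj) => u.
  by rewrite mulrC.
have two0 : 0 <= 2 :> R by lra.
by apply: eq_psd (psdZ two0 h) => j k; field.
Qed.

Lemma psd_ker_autocorrelation :
  psd (fun j k => 1 / 180 + (ker (p j) (p k) - 1 / 3) / 3 - (ker (p j) (p k) - 1 / 3) ^+ 2).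
Proof.
have h : psd (fun j k =>
    (1 / 180 + (ker (p j) (p k) - 1 / 3) / 3 - (ker (p j) (p k) - 1 / 3) ^+ 2) / 6).
  apply: (@psd_has_int _ (fun j u => ker (p j) u - 1 / 3) _ 0 1) => [j k|j k]; last by rewrite kerC.
  case: (leP (p j) (p k)) => [jk|/ltW kj]; first exact: has_int_ker.
  rewrite kerC; apply: eq_has_int (has_int_ker (p01 k) (p01 j) kj) => u.
  by rewrite mulrC.
have six0 : 0 <= 6 :> R by lra.
by apply: eq_psd (psdZ six0 h) => j k; field.
Qed.

(** In Bernoulli terms this is [1/2 + 3 B_2 / 4], chosen so that its square is still dominated by
    [ker]. *)
Definition sker (s t : R) : R := (1 + 3 * ker s t) / 4.

Lemma sker_diag s : sker s s = 5 / 8.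
Proof. by rewrite /sker ker_diag; field. Qed.

Lemma psd_sker : psd (fun j k => sker (p j) (p k)).
Proof.
have half0 : 0 <= 1 / 2 :> R by lra.
have tq0 : 0 <= 3 / 4 :> R by lra.
apply: eq_psd (psdD (psd_cst half0) (psdZ tq0 psd_ker_third)) => j k.
by rewrite /sker; field.
Qed.

Lemma psd_ker_sub_sker2 : psd (fun j k => ker (p j) (p k) - sker (p j) (p k) ^+ 2).
Proof.
(* With [B = ker - 1/3] the difference is [1/12 + B/4 - 9 B^2 / 16]. The autocorrelation with
   coefficient 9/16 absorbs the square and leaves [77/960 + B/16]. *)
have c0 : 0 <= 77 / 960 :> R by lra.
have c1 : 0 <= 1 / 16 :> R by lra.
have c2 : 0 <= 9 / 16 :> R by lra.
apply: eq_psd (psdD (psdD (psd_cst c0) (psdZ c1 psd_ker_third))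
  (psdZ c2 psd_ker_autocorrelation)) => j k.
by rewrite /sker; field.
Qed.

End KernelMatrices.

(** * Lower bounds for the quadratic form *)

Section LowerBounds.
Context {R : realType}.
Variables (d N : nat) (P : 'I_N -> nat -> R).
Hypothesis P01 : forall (j : 'I_N) (i : 'I_d), 0 <= P j i < 1.

Definition kerd (j k : 'I_N) : R := \prod_(i < d) ker (P j i) (P k i).

Lemma qform_kerd_pos (w : 'I_N -> R) : (forall j, 0 <= w j) ->
  (1 / 2) ^+ d * (\sum_j w j) ^+ 2 <= N%:R * qform kerd w.
Proof.
move=> w0; apply: le_trans (_ : N%:R * ((1 / 2) ^+ d * \sum_j w j ^+ 2) <= _).
  rewrite [leRHS]mulrCA ler_wpM2l ?exprn_ge0//.
  by have := sum_sqr_le w; rewrite card_ord.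
rewrite ler_wpM2l//; apply: qform_diag => //.
  by move=> j k; apply: prodr_ge0 => i _; exact: ker_ge0.
move=> j; rewrite /kerd (eq_bigr (fun=> 1 / 2)) => [|i _]; last exact: ker_diag.
by rewrite prodr_const card_ord.
Qed.

Lemma qform_kerd (w : 'I_N -> R) :
  (25 / 64) ^+ d * (\sum_j w j) ^+ 2 <= N%:R * qform kerd w.
Proof.
pose A (i : 'I_d) j k := sker (P j i) (P k i).
pose G j k := \prod_(i < d) A i j k.
have pA i : psd (A i) by apply: psd_sker => j; exact: P01.
have GE j : G j j = (5 / 8) ^+ d.
  rewrite /G (eq_bigr (fun=> 5 / 8)) => [|i _]; last exact: sker_diag.
  by rewrite prodr_const card_ord.
have := schur_sqr_ge w (psd_prod (index_enum 'I_d) pA).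
rewrite card_ord -/(G _ _).
have -> : \sum_j w j * \prod_(i < d) A i j j = (5 / 8) ^+ d * \sum_j w j.
  by rewrite mulr_sumr; apply: eq_bigr => j _; rewrite -/(G j j) GE mulrC.
have -> : ((5 / 8) ^+ d * \sum_j w j) ^+ 2 = (25 / 64) ^+ d * (\sum_j w j) ^+ 2.
  by rewrite exprMn -exprM mulnC exprM; congr (_ ^+ d * _); field.
move/le_trans; apply; rewrite ler_wpM2l//.
(* The one-dimensional domination passes to the product over coordinates. *)
have [_ /(_ w)] : psd (fun j k => kerd j k - \prod_(i < d) (A i j k * A i j k)).
  apply: psd_prodB => i; first by apply: psdM.
  by apply: psd_ker_sub_sker2 => j; exact: P01.
set L := fun j k => \prod_(i < d) (A i j k * A i j k).
have -> : qform kerd w = qform (fun j k => kerd j k - L j k) w + qform L w.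
  rewrite -qformD; congr (qform _ w); apply/funext => j; apply/funext => k.
  by rewrite subrK.
have -> : qform (fun j k => (\prod_(i < d) A i j k) ^+ 2) w = qform L w.
  congr (qform _ w); apply/funext => j; apply/funext => k.
  by rewrite /L expr2 -big_split.
by move=> h; rewrite lerDr.
Qed.

(* With [r = (3 rho) ^+ d] the hypotheses give [1 - 2 W + r W ^+ 2 / N <= eps ^+ 2], whose
   left-hand side is at least [1 - N / r]. *)
Lemma size_ge (eps rho Q W : R) : 0 < rho -> (N = 0%N -> W = 0 /\ Q = 0) -> 0 < eps < 1 ->
  rho ^+ d * W ^+ 2 <= N%:R * Q ->
  (1 / 3) ^+ d * (1 - 2 * W) + Q <= eps ^+ 2 * (1 / 3) ^+ d ->
  (1 - eps ^+ 2) * (3 * rho) ^+ d <= N%:R.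
Proof.
move=> rho0 N0 eps01 WQ small.
have t0 : 0 < (1 / 3 : R) ^+ d by rewrite exprn_gt0//; lra.
have r0 : 0 < (3 * rho) ^+ d by rewrite exprn_gt0//; lra.
have e1 : eps ^+ 2 < 1 by rewrite expr2; nra.
have rhoE : rho ^+ d = (3 * rho) ^+ d * (1 / 3) ^+ d by rewrite -exprMn; congr (_ ^+ d); field.
(* Without points the squared discrepancy is [3^-d], which exceeds the threshold since [eps < 1]. *)
have Ngt0 : (0 < N)%N.
  rewrite lt0n; apply/eqP => /N0[W0 Q0]; move: small.
  by rewrite W0 Q0 mulr0 subr0 mulr1 addr0 leNgt gtr_pMl// e1.
have n0 : 0 < N%:R :> R by rewrite ltr0n.
move: rhoE WQ small t0 r0; set r := (3 * rho) ^+ d; set t := (1 / 3) ^+ d => rhoE WQ small t0 r0.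
have step1 : N%:R * (1 - eps ^+ 2) <= 2 * N%:R * W - r * W ^+ 2.
  rewrite -(ler_pM2l t0).
  have : N%:R * (t * (1 - 2 * W) + Q) <= N%:R * (eps ^+ 2 * t) by rewrite ler_pM2l.
  by move: WQ; rewrite rhoE => WQ h; nra.
(* The maximum over [W], attained at [W = N / r]. *)
have step2 : r * (2 * N%:R * W - r * W ^+ 2) <= N%:R ^+ 2.
  by have := sqr_ge0 (N%:R - r * W); nra.
rewrite -(ler_pM2l n0) mulrA -expr2 mulrC; apply: le_trans step2.
by rewrite ler_pM2l.
Qed.

End LowerBounds.

(** * The discrepancy formula *)

Section IteratedIntegral.
Context {R : realType}.
Variable K : finType.

(** Freezing the outermost coordinate turns its factor into part of the coefficient, so the
    induction is over all [c]. *)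
Lemma iint_sum_prod n (c : K -> R) (f : K -> nat -> R -> R) (v : K -> nat -> R) :
  (forall k i, (i < n)%N -> has_int (f k i) 0 1 (v k i)) ->
  iint n (fun z => (\sum_k c k * \prod_(i < n) f k i (z i))%:E) =
  (\sum_k c k * \prod_(i < n) v k i)%:E.
Proof.
elim: n c => [|n ih] c fv /=.
  by congr EFin; apply: eq_bigr => k _; rewrite !big_ord0.
have [_ <-] : has_int (fun t => \sum_k (c k * \prod_(i < n) v k i) * f k n t) 0 1
    (\sum_k c k * \prod_(i < n.+1) v k i).
  have -> : \sum_k c k * \prod_(i < n.+1) v k i = \sum_k (c k * \prod_(i < n) v k i) * v k n.
    by apply: eq_bigr => k _; rewrite big_ord_recr mulrA.
  by apply: has_int_sum => k _; apply: has_intZ; exact: fv.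
apply: eq_integral => t _.
transitivity (iint n (fun z => (\sum_k (c k * f k n t) * \prod_(i < n) f k i (z i))%:E)).
  congr iint; apply/funext => z; congr EFin; apply: eq_bigr => k _.
  rewrite big_ord_recr/= /upd eqxx mulrAC mulrA; congr (_ * _ * _).
  by apply: eq_bigr => i _; rewrite ltn_eqF.
rewrite ih => [|k i ilt]; last by apply: fv; exact: ltnW.
by congr EFin; apply: eq_bigr => k _; rewrite mulrAC.
Qed.

(* [f k i (z i) (z (d + i))] for the pairs both of whose members are still to be
   integrated, [h k i (z i)] for those whose second member has been frozen. *)
Lemma iint_sum_prod_pairs d m (c : K -> R) (f : K -> nat -> R -> R -> R)
    (h : K -> nat -> R -> R) (v u : K -> nat -> R) : (m <= d)%N ->
  (forall k i, (i < d)%N -> has_int2 (f k i) (v k i)) ->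
  (forall k i, (m <= i < d)%N -> has_int (h k i) 0 1 (u k i)) ->
  iint (d + m) (fun z => (\sum_k c k * \prod_(i < d)
    (if (i < m)%N then f k i (z i) (z (d + i)%N) else h k i (z i)))%:E) =
  (\sum_k c k * \prod_(i < d) (if (i < m)%N then v k i else u k i))%:E.
Proof.
elim: m h u => [|m ih] h u md fv hu; first by rewrite addn0; exact: iint_sum_prod.
have gP k : exists g : R -> R, (forall y, 0 <= y <= 1 -> has_int ((f k m)^~ y) 0 1 (g y)) /\
    has_int g 0 1 (v k m).
  by have [g g1 g2] := fv k m md; exists g.
(* One inner integral is selected for each [k], giving a family to be integrated termwise. *)
have {gP}[g gP] := choice gP.
rewrite addnS/=.
pose m' := Ordinal md.
pose r k := \prod_(i < d | i != m') (if (i < m)%N then v k i else u k i).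
have rE k (a : R) :
    \prod_(i < d) (if (i < m)%N then v k i else if i == m :> nat then a else u k i) = r k * a.
  rewrite (bigD1 m')//= ltnn eqxx mulrC; congr (_ * _); apply: eq_bigr => i im.
  by rewrite [_ == m](negbTE im).
have splitE (i : 'I_d) (a b : R) : (if (i < m.+1)%N then a else b) =
    if (i < m)%N then a else if i == m :> nat then a else b.
  by rewrite ltnS leq_eqVlt; case: (i == m :> nat); case: (i < m)%N.
have [_ <-] : has_int (fun t => \sum_k (c k * r k) * g k t) 0 1
    (\sum_k c k * \prod_(i < d) (if (i < m.+1)%N then v k i else u k i)).
  have -> : \sum_k c k * \prod_(i < d) (if (i < m.+1)%N then v k i else u k i) =
      \sum_k (c k * r k) * v k m.
    apply: eq_bigr => k _; rewrite -mulrA -rE; congr (_ * _); apply: eq_bigr => i _.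
    by rewrite splitE; case: eqP => // ->.
  by apply: has_int_sum => k _; apply: has_intZ; case: (gP k).
apply: eq_integral => t; rewrite inE/= in_itv/= => t01.
(* Once the second member of pair [m] is fixed at [t], its factor depends on one variable and has
   integral [g k t]. *)
pose h' k i := if i == m then (f k m)^~ t else h k i.
pose u' k i := if i == m then g k t else u k i.
transitivity (iint (d + m) (fun z => (\sum_k c k * \prod_(i < d)
    (if (i < m)%N then f k i (z i) (z (d + i)%N) else h' k i (z i)))%:E)).
  congr iint; apply/funext => z; congr EFin; apply: eq_bigr => k _; congr (_ * _).
  apply: eq_bigr => i _; rewrite splitE /upd /h' eqn_add2l ltn_eqF; last first.
    by rewrite (leq_trans (ltn_ord i))// leq_addr.
  by case: ltnP => [im|]; [rewrite ltn_eqF|case: eqP => // ->].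
have hu' k i : (m <= i < d)%N -> has_int (h' k i) 0 1 (u' k i).
  move=> /andP[mi id]; rewrite /h' /u'; case: eqP => [_|/eqP im].
    by case: (gP k) => + _; exact.
  by apply: hu; rewrite id andbT ltn_neqAle eq_sym im.
rewrite (ih h' u' (ltnW md) fv hu').
by congr EFin; apply: eq_bigr => k _; rewrite -mulrA -rE.
Qed.

Lemma iint_sum_prod2 d (c : K -> R) (f : K -> nat -> R -> R -> R) (v : K -> nat -> R) :
  (forall k i, (i < d)%N -> has_int2 (f k i) (v k i)) ->
  iint (d + d) (fun z => (\sum_k c k * \prod_(i < d) f k i (z i) (z (d + i)%N))%:E) =
  (\sum_k c k * \prod_(i < d) v k i)%:E.
Proof.
move=> fv.
transitivity (iint (d + d) (fun z => (\sum_k c k * \prod_(i < d)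
    (if (i < d)%N then f k i (z i) (z (d + i)%N) else 0))%:E)).
  congr iint; apply/funext => z; congr EFin; apply: eq_bigr => k _.
  by congr (_ * _); apply: eq_bigr => i _; rewrite ltn_ord.
(* At [m = d] no pair is frozen, so the zero functions are placeholders. *)
rewrite (@iint_sum_prod_pairs _ _ c f (fun _ _ _ => 0) v (fun _ _ => 0))//; last first.
  by move=> k i /andP[/leq_ltn_trans/[apply]]; rewrite ltnn.
congr EFin; apply: eq_bigr => k _.
by congr (_ * _); apply: eq_bigr => i _; rewrite ltn_ord.
Qed.

End IteratedIntegral.

(** * The squared discrepancy as a quadratic function of the weights *)

Section DiscrepancyFormula.
Context {R : realType}.

Lemma sum_option (T : finType) (F : option T -> R) :
  \sum_o F o = F None + \sum_j F (Some j).
Proof.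
rewrite (bigD1 None)//=; congr (_ + _).
rewrite (reindex_omap Some id) => [|[i|]//].
by apply: eq_bigl => j; rewrite eqxx.
Qed.

Variables (d N : nat) (P : 'I_N -> nat -> R) (w : 'I_N -> R).
Hypothesis P01 : forall (j : 'I_N) (i : 'I_d), 0 <= P j i < 1.

(* [Delta] is a linear combination of product functions, [None] standing for the
   volume term. *)
Let coef (o : option 'I_N) : R := if o is Some j then w j else -1.
Let factor (o : option 'I_N) (i : nat) (x y : R) : R :=
  if o is Some j then (inI x y (P j i))%:R else lenI x y.
Let inner (o o' : option 'I_N) (i : nat) : R :=
  if o is Some j then if o' is Some k then ker (P j i) (P k i) else 1 / 3 else 1 / 3.

Let DeltaE x y : Delta d P w x y = \sum_o coef o * \prod_(i < d) factor o i (x i) (y i).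
Proof.
rewrite sum_option /= mulN1r addrC /Delta; congr (_ - _).
rewrite big_mkcond; apply: eq_bigr => j _.
rewrite /inB; case: ifPn => [/forallP xy|].
  by rewrite big1 ?mulr1// => i _; rewrite xy.
rewrite negb_forall => /existsP[i /negbTE xy].
by rewrite (bigD1 i)//= xy mul0r mulr0.
Qed.

Let has_int2_factor o o' i : (i < d)%N ->
  has_int2 (fun x y => factor o i x y * factor o' i x y) (inner o o' i).
Proof.
move=> id; have p01 j : 0 <= P j i < 1 := P01 j (Ordinal id).
case: o o' => [j|] [k|] /=.
- exact: has_int2_inI.
- exact: has_int2_inI_lenI.
- have [g gi gv] := has_int2_inI_lenI (p01 k); exists g => // y /gi.
  by apply: eq_has_int => x; rewrite mulrC.
- exact: has_int2_lenI.
Qed.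

Lemma L2per_sqE : L2per_sq d P w =
  ((1 / 3) ^+ d * (1 - 2 * \sum_j w j) + qform (kerd d P) w)%:E.
Proof.
rewrite /L2per_sq.
transitivity (iint (d + d) (fun z => (\sum_(o : option 'I_N * option 'I_N)
    (coef o.1 * coef o.2) * \prod_(i < d)
      (factor o.1 i (z i) (z (d + i)%N) * factor o.2 i (z i) (z (d + i)%N)))%:E)).
  congr iint; apply/funext => z; congr EFin; rewrite DeltaE expr2 mulr_suml.
  rewrite -(pair_bigA _ (fun o o' => (coef o * coef o') * \prod_(i < d)
      (factor o i (z i) (z (d + i)%N) * factor o' i (z i) (z (d + i)%N))))/=.
  apply: eq_bigr => o _; rewrite mulr_sumr; apply: eq_bigr => o' _.
  by rewrite big_split/= mulrACA.
rewrite (@iint_sum_prod2 _ _ _ (fun o => coef o.1 * coef o.2)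
  (fun o i x y => factor o.1 i x y * factor o.2 i x y) (fun o => inner o.1 o.2)); last first.
  by move=> oo' i; exact: has_int2_factor.
congr EFin.
rewrite -(pair_bigA _ (fun o o' => (coef o * coef o') * \prod_(i < d) inner o o' i))/=.
have third : \prod_(i < d) (1 / 3 : R) = (1 / 3) ^+ d by rewrite prodr_const card_ord.
(* The volume-volume pair gives [3^-d], the two mixed families [- 2 W 3^-d], and the pairs of points
   the form of [kerd]. *)
rewrite !sum_option /= third.
under [X in _ + X]eq_bigr => j _ do rewrite sum_option /= third.
rewrite big_split/=.
have -> : \sum_j -1 * w j * (1 / 3) ^+ d = - (\sum_j w j) * (1 / 3) ^+ d.
  by rewrite -mulr_suml -mulr_sumr mulN1r.
have -> : \sum_j w j * -1 * (1 / 3) ^+ d = - (\sum_j w j) * (1 / 3) ^+ d.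
  by rewrite -mulr_suml -mulr_suml mulrN1.
by rewrite /qform /kerd; ring.
Qed.

Lemma admissible_le (eps : R) : admissible eps d P w ->
  (1 / 3) ^+ d * (1 - 2 * \sum_j w j) + qform (kerd d P) w <= eps ^+ 2 * (1 / 3) ^+ d.
Proof.
have third : ((Num.sqrt 3 ^+ d)^-1) ^+ 2 = (1 / 3) ^+ d :> R.
  by rewrite -!exprVn -exprM mulnC exprM exprVn sqr_sqrtr// div1r.
by rewrite /admissible L2per_sqE lee_fin (exprMn _ eps) third.
Qed.

End DiscrepancyFormula.

(** * Assembly of the three lower bounds *)

Theorem theorem2 (R : realType) :
  (forall (eps : R) (d N : nat) (P : 'I_N -> (nat -> R)),
     0 < eps < 1 -> pointset d P -> admissible eps d P (@eqw R N) ->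
     (1 + eps ^+ 2)^-1 * (3 / 2) ^+ d <= N%:R) /\
  (forall (eps : R) (d N : nat) (P : 'I_N -> (nat -> R)) (w : 'I_N -> R),
     0 < eps < 1 -> pointset d P -> (forall j, 0 < w j) -> admissible eps d P w ->
     (1 - eps ^+ 2) * (3 / 2) ^+ d <= N%:R) /\
  (forall eps0 : R, 0 < eps0 < 1 ->
     exists c : R, 0 < c /\
       forall (eps : R) (d N : nat) (P : 'I_N -> (nat -> R)) (w : 'I_N -> R),
         0 < eps < eps0 -> pointset d P -> admissible eps d P w ->
         c * (10628%:R / 10000%:R) ^+ d <= N%:R).
Proof.
have empty d N (P : 'I_N -> nat -> R) (w : 'I_N -> R) :
    N = 0%N -> \sum_j w j = 0 /\ qform (kerd d P) w = 0.
  by move=> N0; subst N; rewrite /qform !big_ord0.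
split; [|split].
- move=> eps d N P eps01 [_ P01] /(admissible_le P01) small.
  have t0 : 0 < (1 / 3 : R) ^+ d by rewrite exprn_gt0//; lra.
  have e1 : eps ^+ 2 < 1 by rewrite expr2; nra.
  have [N0|N0] := posnP N.
    have [W0 Q0] := empty d N P (@eqw R N) N0; move: small.
    by rewrite W0 Q0 mulr0 subr0 mulr1 addr0 leNgt gtr_pMl// e1.
  have n0 : 0 < N%:R :> R by rewrite ltr0n.
  (* With total weight 1 the constraint reads [Q <= (1 + eps^2) 3^-d], to be compared with
     [2^-d <= N Q]. *)
  have W1 : \sum_(j < N) @eqw R N j = 1.
    by rewrite sumr_const card_ord -[_ *+ _]mulr_natl mulfV ?gt_eqF.
  have w0 (j : 'I_N) : 0 <= @eqw R N j by rewrite invr_ge0.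
  have := qform_kerd_pos d P w0; rewrite W1 expr1n mulr1 => low.
  rewrite W1 mulr1 in small.
  have e2 : 0 < 1 + eps ^+ 2 by rewrite ltr_wpDr ?sqr_ge0.
  rewrite ler_pdivrMl// -(ler_pM2r t0) -exprMn.
  have -> : 3 / 2 * (1 / 3) = 1 / 2 :> R by field.
  apply: le_trans low _; rewrite mulrAC mulrC ler_pM2r//.
  by lra.
- move=> eps d N P w eps01 [_ P01] w0 /(admissible_le P01) small.
  have -> : 3 / 2 = 3 * (1 / 2) :> R by field.
  apply: (size_ge _ _ _ _ small); [lra|exact: empty|by []|].
  by apply: qform_kerd_pos => j; exact: ltW.
- move=> eps0 eps01; have e1 : eps0 ^+ 2 < 1 by rewrite expr2; nra.
  exists (1 - eps0 ^+ 2); split; first by rewrite subr_gt0.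
  move=> eps d N P w /andP[eps_gt0 eps_lt] [_ P01] /(admissible_le P01) small.
  have eps1 : 0 < eps < 1 by move: eps01; lra.
  have [r0 rho0] : 0 <= 10628%:R / 10000%:R :> R /\ 0 < 25 / 64 :> R by split; lra.
  apply: le_trans (size_ge rho0 (@empty d N P w) eps1 (qform_kerd P01 w) small).
  apply: ler_pM; [by rewrite subr_ge0 ltW|exact: exprn_ge0| |].
  + by rewrite lerB// ler_pXn2r// ?nnegrE; lra.
  + by apply: lerXn2r; rewrite ?nnegrE; lra.
Qed.
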